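(* Let $\mathbf V$ be a pseudovariety of monoids such that $(\mathbf V\cap \mathbf{Ab})\ast \mathbf V=\mathbf V$. Then every closed subgroup of a free pro-$\mathbf V$ monoid is a projective profinite group, and in particular is torsion-free.
   Context: A pseudovariety of monoids is a class of finite monoids closed under finite direct products, submonoids and homomorphic images. $\mathbf{Ab}$ is the pseudovariety of finite abelian groups. For pseudovarieties of monoids $\mathbf V,\mathbf W$, $\mathbf V\ast\mathbf W$ denotes the pseudovariety of monoids generated by all semidirect products $V\rtimes W$ with $V\in\mathbf V$, $W\in\mathbf W$; here $W$ acts on the left of $V$ by monoid endomorphisms (with $1\in W$ acting as the identity), and the multiplication on $V\times W$ is $(v,w)(v',w')=(v\cdot{}^{w}v',ww')$. A pro-$\mathbf V$ monoid is a topological monoid that is a projective limit of (discrete) members of $\mathbf V$. For a topological space $X$, the free pro-$\mathbf V$ monoid on $X$ is the pro-$\mathbf V$ monoid $\widehat{F_{\mathbf V}}(X)$ equipped with a continuous map $X\to\widehat{F_{\mathbf V}}(X)$ such that every continuous map from $X$ to a pro-$\mathbf V$ monoid $M$ extends uniquely to a continuous monoid homomorphism $\widehat{F_{\mathbf V}}(X)\to M$. A closed subgroup of a profinite monoid is a topologically closed subsemigroup that is a group under the induced multiplication (its identity is an idempotent, not necessarily the identity of the monoid); it is given the induced topology. A profinite group $G$ is projective if for every finite group $A$, every epimorphism of finite groups $\alpha:A\to B$, and every continuous epimorphism $\varphi:G\to B$ ($B$ discrete), there is a continuous homomorphism $\widetilde\varphi:G\to A$ with $\alpha\circ\widetilde\varphi=\varphi$.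 *)

(* Defs.v *)
(* In MathComp-Analysis 1.16 a topologicalType need be neither pointed nor
   Hausdorff. *)
From HB Require Import structures.
From mathcomp Require Import all_boot fingroup.
From mathcomp Require Import boolp classical_sets functions cardinality topology.

Set Implicit Arguments.
Unset Strict Implicit.
Unset Printing Implicit Defensive.

Local Open Scope classical_set_scope.
Local Open Scope group_scope.

Definition finite_monoid (M : monoidType) : Prop := finite_set [set: M].

Definition monoid_is_group (M : monoidType) : Prop :=
  forall x : M, exists y : M, x * y = 1 /\ y * x = 1.

Definition finite_group (M : monoidType) : Prop :=
  finite_monoid M /\ monoid_is_group M.

Definition Ab (M : monoidType) : Prop :=
  finite_group M /\ commutative (@mul M).

(* Submonoids are taken up to isomorphism, as domains of injective morphisms;
   the one-element monoids are the empty products. *)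
Record pseudovariety (V : monoidType -> Prop) : Prop := Pseudovariety {
  pv_finite : forall M : monoidType, V M -> finite_monoid M ;
  pv_trivial : forall M : monoidType, (forall x : M, x = 1) -> V M ;
  pv_prod : forall M N : monoidType, V M -> V N -> V (M * N)%type ;
  pv_sub : forall (M N : monoidType) (f : M -> N),
    monoid_morphism f -> injective f -> V N -> V M ;
  pv_img : forall (M N : monoidType) (f : M -> N),
    monoid_morphism f -> set_surj [set: M] [set: N] f -> V M -> V N }.

Definition pv_generated (C : monoidType -> Prop) (M : monoidType) : Prop :=
  forall P : monoidType -> Prop,
    pseudovariety P -> (forall N, C N -> P N) -> P M.

Record left_action (N W : monoidType) := LeftAction {
  lact :> W -> N -> N ;
  lact_endo : forall w, monoid_morphism (lact w) ;
  lact1 : forall n, lact 1 n = n ;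
  lactM : forall w w' n, lact (w * w') n = lact w (lact w' n) }.

Definition semidirect (N W : monoidType) (a : left_action N W) : Type :=
  (N * W)%type.

Section Semidirect.
Context {N W : monoidType} (a : left_action N W).

HB.instance Definition _ := Choice.copy (semidirect a) (N * W)%type.

Definition sd_mul (x y : semidirect a) : semidirect a :=
  (x.1 * a x.2 y.1, x.2 * y.2).
Definition sd_one : semidirect a := (1, 1).

Fact sd_mulA : associative sd_mul.
Proof.
by move=> x y z; rewrite /sd_mul /= (lact_endo a _).2 lactM !mulgA.
Qed.

Fact sd_mul1g : left_id sd_one sd_mul.
Proof. by case=> n w; rewrite /sd_mul /= lact1 !mul1g. Qed.

Fact sd_mulg1 : right_id sd_one sd_mul.
Proof. by case=> n w; rewrite /sd_mul /= (lact_endo a _).1 !mulg1. Qed.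

HB.instance Definition _ :=
  isMonoid.Build (semidirect a) sd_mulA sd_mul1g sd_mulg1.

End Semidirect.

Inductive semidirect_products (V W : monoidType -> Prop) : monoidType -> Prop :=
  SemidirectProduct (N K : monoidType) (a : left_action N K) :
    V N -> W K -> semidirect_products V W (semidirect a).

Definition semidirect_pv (V W : monoidType -> Prop) : monoidType -> Prop :=
  pv_generated (semidirect_products V W).

(* No compatibility is built into these two joins: continuity of the operations
   is required by [topological_monoid] and [topological_group]. *)
#[short(type="preTopologicalMonoidType")]
HB.structure Definition PreTopologicalMonoid :=
  {M of Monoid M & Topological M}.

#[short(type="preTopologicalGroupType")]
HB.structure Definition PreTopologicalGroup :=
  {G of monoid.Group G & Topological G}.

Definition topological_monoid (M : preTopologicalMonoidType) : Prop :=
  continuous (fun xy : M * M => xy.1 * xy.2).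

Definition topological_group (G : preTopologicalGroupType) : Prop :=
  topological_monoid G /\ continuous (fun x : G => x^-1).

(* Only the maps [isys_map i j] with [isys_le i j] are meaningful. *)
Record inverse_system := InverseSystem {
  isys_idx : Type ;
  isys_le : isys_idx -> isys_idx -> Prop ;
  isys_obj : isys_idx -> monoidType ;
  isys_map : forall i j, isys_obj j -> isys_obj i ;
  isys_inhabited : inhabited isys_idx ;
  isys_le_refl : forall i, isys_le i i ;
  isys_le_trans : forall i j k, isys_le i j -> isys_le j k -> isys_le i k ;
  isys_directed : forall i j, exists k, isys_le i k /\ isys_le j k ;
  isys_morph : forall i j, isys_le i j -> monoid_morphism (@isys_map i j) ;
  isys_map_id : forall i x, @isys_map i i x = x ;
  isys_map_comp : forall i j k x, isys_le i j -> isys_le j k ->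
    @isys_map i j (@isys_map j k x) = @isys_map i k x }.

(* As a subset of the product of the discrete spaces [isys_obj i]; its
   coercion to a type carries the induced topology. *)
Definition isys_lim (S : inverse_system) :
    set (prod_topology (fun i : isys_idx S => discrete_topology (isys_obj i))) :=
  [set t | forall i j, isys_le i j -> isys_map i (t j) = t i].

Arguments isys_lim : clear implicits.

(* [M] is isomorphic, as a topological monoid, to the limit of [S], whose
   operations are componentwise. *)
Definition is_projective_limit (M : preTopologicalMonoidType)
    (S : inverse_system) : Prop :=
  exists (h : M -> isys_lim S) (g : isys_lim S -> M),
    [/\ cancel h g, cancel g h, continuous h, continuous g &
        forall i : isys_idx S,
          monoid_morphism (fun x => set_val (h x) i : isys_obj i)].

Definition projective_limit_of (V : monoidType -> Prop)
    (M : preTopologicalMonoidType) : Prop :=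
  exists S : inverse_system,
    (forall i : isys_idx S, V (isys_obj i)) /\ is_projective_limit M S.

Definition pro (V : monoidType -> Prop) (M : preTopologicalMonoidType) : Prop :=
  topological_monoid M /\ projective_limit_of V M.

Definition is_free_pro (V : monoidType -> Prop) (X : topologicalType)
    (F : preTopologicalMonoidType) (iota : X -> F) : Prop :=
  [/\ pro V F, continuous iota &
      forall (M : preTopologicalMonoidType) (f : X -> M),
        pro V M -> continuous f ->
        exists! g : F -> M,
          [/\ continuous g, monoid_morphism g & forall x, g (iota x) = f x]].

(* The identity [e] of the subgroup need not be that of [M]. *)
Definition is_subgroup (M : monoidType) (H : set M) : Prop :=
  (forall x y, H x -> H y -> H (x * y)) /\
  exists e, [/\ H e, forall x, H x -> e * x = x /\ x * e = x &
    forall x, H x -> exists y, [/\ H y, x * y = e & y * x = e]].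

Record closed_subgroup (M : preTopologicalMonoidType) := ClosedSubgroup {
  csg_set :> set M ;
  csg_closed : closed csg_set ;
  csg_subgroup : is_subgroup csg_set }.

Definition csg_type (M : preTopologicalMonoidType) (H : closed_subgroup M) :
  Type := set_type H.

Section ClosedSubgroup.
Context {M : preTopologicalMonoidType} (H : closed_subgroup M).

HB.instance Definition _ := Topological.copy (csg_type H) (set_type H).

Definition csg_mul (x y : csg_type H) : csg_type H :=
  SigSub (mem_set ((csg_subgroup H).1 _ _ (set_valP x) (set_valP y))).

Fact csg_group_ex : exists oi : csg_type H * (csg_type H -> csg_type H),
  [/\ left_id oi.1 csg_mul, right_id oi.1 csg_mul,
      left_inverse oi.1 oi.2 csg_mul & right_inverse oi.1 oi.2 csg_mul].
Proof.
have [_ [e [He idP invP]]] := csg_subgroup H.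
have /choice [i iP] (x : csg_type H) : exists y : csg_type H,
    set_val x * set_val y = e /\ set_val y * set_val x = e.
  by have [y [Hy xy yx]] := invP _ (set_valP x); exists (SigSub (mem_set Hy)).
exists (SigSub (mem_set He), i); split=> x /=; apply: val_inj => /=.
- by have [] := idP _ (set_valP x).
- by have [] := idP _ (set_valP x).
- by have [] := iP x.
- by have [] := iP x.
Qed.

Definition csg_one : csg_type H := (sval (cid csg_group_ex)).1.
Definition csg_inv : csg_type H -> csg_type H := (sval (cid csg_group_ex)).2.

Fact csg_mulA : associative csg_mul.
Proof. by move=> x y z; apply: val_inj; rewrite /= mulgA. Qed.

Fact csg_mul1g : left_id csg_one csg_mul.
Proof. by rewrite /csg_one; case: cid => ? []. Qed.

Fact csg_mulg1 : right_id csg_one csg_mul.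
Proof. by rewrite /csg_one; case: cid => ? []. Qed.

Fact csg_mulVg : left_inverse csg_one csg_inv csg_mul.
Proof. by rewrite /csg_one /csg_inv; case: cid => ? []. Qed.

Fact csg_mulgV : right_inverse csg_one csg_inv csg_mul.
Proof. by rewrite /csg_one /csg_inv; case: cid => ? []. Qed.

HB.instance Definition _ := isGroup.Build (csg_type H)
  csg_mulA csg_mul1g csg_mulg1 csg_mulVg csg_mulgV.

End ClosedSubgroup.

Definition profinite_group (G : preTopologicalGroupType) : Prop :=
  topological_group G /\ projective_limit_of finite_group G.

Definition projective_profinite_group (G : preTopologicalGroupType) : Prop :=
  profinite_group G /\
  forall (A B : finGroupType) (alpha : A -> B) (phi : G -> discrete_topology B),
    monoid_morphism alpha -> set_surj [set: A] [set: B] alpha ->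
    continuous phi -> monoid_morphism (phi : G -> B) ->
    set_surj [set: G] [set: B] phi ->
    exists psi : G -> discrete_topology A,
      [/\ continuous psi, monoid_morphism (psi : G -> A) &
          forall x, alpha (psi x) = phi x].

Definition torsion_free (G : groupType) : Prop :=
  forall (x : G) (n : nat), (0 < n)%N -> x ^+ n = 1 -> x = 1.

(* Main.v *)
Require Import Defs.
From HB Require Import structures.
From mathcomp Require Import all_boot.
From mathcomp Require Import boolp classical_sets functions cardinality topology.
From mathcomp Require Import fintype finset all_fingroup zmodp all_solvable.

(** Let [H] be a closed subgroup of the free pro-[V] monoid [F] on [X].  The
    heart of the matter is to lift a continuous morphism [phi : H -> B], with [B]
    finite, through an epimorphism [A -> B] of finite groups whose kernel [K] is
    abelian and belongs to [V].

    By compactness [phi] factors through the image [N] of [H] under a continuous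
    morphism from [F] to some [M] in [V].  The group [N] need not contain the
    identity of [M], and a morphism defined on [N] need not extend to [M].  But
    [N] acts freely by left multiplication on the R-class of its identity [e],
    hence on the part of the right Cayley graph of [M] spanned by that R-class
    (an edge leads from [r] to [r * m] for each [m] in [M]).  Choosing
    orbit representatives labels each edge of this graph by an element of [B],
    invariantly under [N]; lifting the labels to [A] turns every path into an
    element of [A], and a path from [e] to [n] in [N] into a lift of the image of
    [n] in [B] (up to a fixed conjugation).  Compared with a section of [A -> B]
    read at both ends of the edge, the lifted label of an edge differs by an
    element of [K].  These differences are recorded by functions [M -> K] and
    multiply along paths by the rule of the wreath product of [K] by [M], a
    semidirect product that the hypothesis on [V] puts in [V].  So the
    morphism [F -> M] lifts to the wreath product by freeness of [F]: the
    generators may be sent anywhere above their images in [M].  The N-invariance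
    of the labels is a property stable under products, which is why the lift can
    be required to take its values in the submonoid where it holds, and why
    reading off the labels gives a morphism on [H] ([wreath_lift],
    [lift_kernel_in_V]).

    If [K] is an elementary abelian p-group, either p divides the order of the
    image of [phi], which is in [V] as a divisor of [M], and then [K] is in [V];
    or the extension splits above that image by the Schur-Zassenhaus theorem
    ([lift_abelem]).  For a general kernel one replaces [A] by a minimal subgroup
    through which lifting is still required; the Frattini argument makes the
    Sylow subgroups of the kernel normal in [A], which yields an elementary
    abelian normal subgroup inside the kernel, and an induction on the order of
    [A] concludes ([lift_finite]).

    Torsion-freeness follows by applying the lifting property to another closed
    subgroup of [F], the finite group generated by a torsion element of order
    [m]: the epimorphism from the cyclic group of order [m ^ 2] onto the cyclic
    group of order [m] has no section unless [m = 1]. *)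

Set Implicit Arguments.
Unset Strict Implicit.
Unset Printing Implicit Defensive.

Local Open Scope classical_set_scope.
Local Open Scope group_scope.

HB.instance Definition _ (M : monoidType) := Monoid.copy (discrete_topology M) M.

(** * Monoid morphisms and finite sets *)

Lemma group_morphism (G K : groupType) (f : G -> K) :
  {morph f : x y / x * y} -> monoid_morphism f.
Proof.
move=> fM; split=> //; apply: (mulgI (f 1)).
by rewrite -fM !mulg1.
Qed.

Lemma idempotent1 (G : groupType) (x : G) : x * x = x -> x = 1.
Proof. by move=> xx; apply: (mulgI x); rewrite xx mulg1. Qed.

Lemma monoid_morphismX (M N : monoidType) (f : M -> N) (x : M) (n : nat) :
  monoid_morphism f -> f (x ^+ n) = f x ^+ n.
Proof.
by move=> [f1 fM]; elim: n => [//|n IHn]; rewrite !expgS fM IHn.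
Qed.

Lemma monoid_expg_mod (M : monoidType) (x : M) (n k : nat) :
  x ^+ n = 1 -> x ^+ (k %% n) = x ^+ k.
Proof.
by move=> xn; rewrite [in RHS](divn_eq k n) expgnDr mulnC expgnA xn expg1n mul1g.
Qed.

Lemma finite_setT_inj (T U : Type) (f : T -> U) :
  injective f -> finite_set [set: U] -> finite_set [set: T].
Proof.
move=> finj Ufin; rewrite -(preimage_setT f); apply: finite_preimage => //.
by move=> x y _ _; exact: finj.
Qed.

(** * Discrete spaces and finite Hausdorff spaces *)

Lemma continuous_discreteP (T : topologicalType) (D : discreteTopologicalType)
    (f : T -> D) :
  continuous f <-> forall x, nbhs x [set y | f y = f x].
Proof.
split=> [cf x|cf x]; first exact: (cf x _ (discrete_set1 _)).
by apply/discrete_cvg; exact: cf.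
Qed.

Lemma initial_cvg (S : choiceType) (T : topologicalType) (f : S -> T)
    (F : set_system S) (s : S) : Filter F ->
  F --> (s : initial_topology f) <-> f @ F --> f s.
Proof.
move=> FF; split=> [Fs|fFs].
  move=> A /initial_continuous; exact: Fs.
move=> A [_ [[B Bop <-] Bfs sBA]].
have fsB : nbhs (f s) B by apply: open_nbhs_nbhs.
exact: filterS sBA (fFs _ fsB).
Qed.

Lemma continuous_discrete_comp (T : topologicalType) (D E : choiceType)
    (g : D -> E) (h : T -> discrete_topology D) :
  continuous h -> continuous (g \o h : T -> discrete_topology E).
Proof.
move=> /continuous_discreteP ch; apply/continuous_discreteP => x.
by apply: filterS (ch x) => y /= ->.
Qed.

Lemma finite_hausdorff_closed (T : topologicalType) (A : set T) :
  hausdorff_space T -> finite_set A -> closed A.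
Proof. by move=> hT /finite_compact; exact: compact_closed. Qed.

Lemma finite_hausdorff_continuous (T : topologicalType) (D : choiceType)
    (f : T -> discrete_topology D) :
  hausdorff_space T -> finite_set [set: T] -> continuous f.
Proof.
move=> hT Tfin; apply/continuous_discreteP => x.
apply: open_nbhs_nbhs; split=> //; rewrite -closedC.
by apply: finite_hausdorff_closed => //; exact: sub_finite_set Tfin.
Qed.

(** An ultrafilter that avoided every fibre of [f] would avoid their finite
    union. *)
Lemma ultra_finite_const (J : Type) (T : choiceType) (U : set_system J)
    (f : J -> T) :
  UltraFilter U -> finite_set [set: T] -> exists t, U [set i | f i = t].
Proof.
move=> UU /finite_seqP [s sP]; apply: contrapT => /forallNP noconst.
suff /filter_ex [i] : U [set i | f i \notin s].
  by have := I : [set: T] (f i); rewrite sP /= => ->.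
elim: s {sP} => [|t s Us]; first by apply: filterS filterT => i.
have [//|Ut] := in_ultra_setVsetC [set i | f i = t] UU; first by have := noconst t.
apply: filterS (filterI Ut Us) => i [/eqP fit fis].
by rewrite /= inE negb_or fit.
Qed.

(** * Limits of discrete monoids as families of projections *)

(** The projections of [M] onto the objects of [S] present [M] as the limit of
    [S]; because [S] is directed, the fibres of single projections suffice to
    describe the neighbourhoods.  Stating this without the subspace of the
    product lets every later argument proceed pointwise. *)
Record prodiscrete (M : preTopologicalMonoidType) (S : inverse_system)
    (p : forall i : isys_idx S, M -> isys_obj i) : Prop := Prodiscrete {
  pd_morph : forall i, monoid_morphism (p i) ;
  pd_map : forall i j x, isys_le i j -> isys_map i (p j x) = p i x ;
  pd_thread : forall t : forall i, isys_obj i,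
    (forall i j, isys_le i j -> isys_map i (t j) = t i) ->
    exists x, forall i, p i x = t i ;
  pd_inj : forall x y, (forall i, p i x = p i y) -> x = y ;
  pd_nbhs : forall x U, nbhs x U <-> exists i, forall y, p i y = p i x -> U y }.

Lemma isys_lim_cvg (S : inverse_system) (F : set_system (isys_lim S))
    (t : isys_lim S) : Filter F ->
  F --> t <-> forall i, F [set u | set_val u i = set_val t i].
Proof.
move=> FF; rewrite initial_cvg cvg_sup; split=> Ft i.
  have /initial_cvg Fti := Ft i.
  exact: (Fti _ (discrete_set1 _)).
apply/initial_cvg/discrete_cvg; exact: Ft.
Qed.

(** For the direct implication, the fibres of the projections at [x] form a base
    of a filter, by directedness; its image in the limit converges to the image
    of [x] because it does so in each coordinate, and the inverse homeomorphism
    carries it back to a filter converging to [x]. *)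
Lemma projective_limitP (M : preTopologicalMonoidType) (S : inverse_system) :
  is_projective_limit M S <->
  exists p : forall i : isys_idx S, M -> isys_obj i, prodiscrete p.
Proof.
have [i0] := isys_inhabited S.
split=> [[h [g [hK gK ch cg hM]]]|[p pdp]].
  exists (fun i x => set_val (h x) i).
  have hle i j x : isys_le i j -> isys_map i (set_val (h x) j) = set_val (h x) i.
    by move=> ij; exact: (set_valP (h x)).
  split=> //.
  - move=> t tP; exists (g (SigSub (mem_set (tP : isys_lim S t)))) => i.
    by rewrite gK.
  - move=> x y xy; apply: (can_inj hK); apply: val_inj.
    exact: functional_extensionality_dep.
  move=> x U; split=> [xU|[i iU]].
    pose F : set_system (isys_lim S) := filter_from [set: isys_idx S]
      (fun i => [set t : isys_lim S | set_val t i = set_val (h x) i]).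
    have FF : Filter F.
      apply: filter_from_filter; first by exists i0.
      move=> i j _ _; have [k [ik jk]] := isys_directed i j; exists k => // t /= tk.
      have tE l : isys_le l k -> set_val t l = set_val (h x) l.
        by move=> lk; rewrite -(hle _ _ x lk) -tk; apply/esym/(set_valP t l k lk).
      by split; exact: tE.
    have /isys_lim_cvg Fx : forall i, F [set u | set_val u i = set_val (h x) i].
      by move=> i; exists i.
    have gU : nbhs (h x) (g @^-1` U) by apply: cg; rewrite hK.
    have [i _ iU] := Fx _ gU; exists i => y yx.
    by rewrite -(hK y); exact: iU.
  have hxi := (isys_lim_cvg (h x) _).1 (ch x) i.
  by apply: (@filterS _ (nbhs x) _ _ _ iU); exact: hxi.
have hP x : isys_lim S (fun i => p i x).
  by move=> i j ij; exact: pd_map.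
have /choice [g gP] (t : isys_lim S) : exists x, forall i, p i x = set_val t i.
  exact: (pd_thread pdp (set_valP t)).
exists (fun x => SigSub (mem_set (hP x))), g; split => //.
- by move=> x; apply: (pd_inj pdp) => i; rewrite gP.
- by move=> t; apply: val_inj; apply: functional_extensionality_dep => i; exact: gP.
- move=> x; apply/isys_lim_cvg => i; apply/(pd_nbhs pdp).
  by exists i => y.
- move=> t U /(pd_nbhs pdp) [i iU].
  have tti := (@isys_lim_cvg S (nbhs t) t _).1 (fun _ => id) i.
  have giU : [set u : isys_lim S | set_val u i = set_val t i] `<=` g @^-1` U.
    by move=> u /= ut; apply: iU; rewrite !gP.
  by apply: (@filterS _ (nbhs t) _ _ _ giU); exact: tti.
by move=> i; exact: pd_morph.
Qed.

Section Prodiscrete.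
Context (M : preTopologicalMonoidType) (S : inverse_system).
Context (p : forall i : isys_idx S, M -> isys_obj i) (pdp : prodiscrete p).

Lemma pd_open i x : nbhs x [set y | p i y = p i x].
Proof. by apply/(pd_nbhs pdp); exists i. Qed.

Lemma pd_continuous i : continuous (p i : M -> discrete_topology (isys_obj i)).
Proof. by apply/continuous_discreteP => x; exact: pd_open. Qed.

Lemma pd_le i j x y : isys_le i j -> p j x = p j y -> p i x = p i y.
Proof. by move=> ij xy; rewrite -!(pd_map pdp _ ij) xy. Qed.

Lemma pd_topological_monoid : topological_monoid M.
Proof.
move=> [x y] U /(pd_nbhs pdp) [i iU].
exists ([set z | p i z = p i x], [set z | p i z = p i y]).
  by split; exact: pd_open.
move=> [x' y'] /= [x'x y'y]; apply: iU => /=.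
by rewrite !(pd_morph pdp i).2 x'x y'y.
Qed.

End Prodiscrete.

(** Compactness, in the form needed here.  If no index worked, pick for each
    index [i] two points that [p i] identifies and [phi] separates.  Along an
    ultrafilter on the indices finer than the tails, each coordinate of these
    points is eventually constant, which defines a thread, that is a point [x].
    Near [x] the map [phi] is constant, yet the chosen pairs come near [x]. *)
Lemma pd_factor (M : preTopologicalMonoidType) (S : inverse_system)
    (p : forall i : isys_idx S, M -> isys_obj i) (D : choiceType)
    (phi : M -> discrete_topology D) :
  prodiscrete p -> (forall i, finite_monoid (isys_obj (i : isys_idx S))) ->
  continuous phi ->
  exists i, forall x y, p i x = p i y -> phi x = phi y.
Proof.
move=> pdp pfin /continuous_discreteP cphi; apply: contrapT => nofactor.
have [i0] := isys_inhabited S.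
have /choice [ab abP] (i : isys_idx S) :
    exists xy : M * M, p i xy.1 = p i xy.2 /\ phi xy.1 <> phi xy.2.
  apply: contrapT => noxy; apply: nofactor; exists i => x y xy.
  by apply: contrapT => phixy; apply: noxy; exists (x, y).
pose tails := filter_from [set: isys_idx S] (fun i => [set j | isys_le i j]).
have tailsP : ProperFilter tails.
  apply: filter_from_proper.
    apply: filter_from_filter; first by exists i0.
    move=> i j _ _; have [k [ik jk]] := isys_directed i j; exists k => // l /= kl.
    by split; apply: isys_le_trans kl.
  by move=> i _; exists i; exact: isys_le_refl.
have [U [UU tailsU]] := ultraFilterLemma tailsP.
have meetU A B : U A -> U B -> exists k, A k /\ B k.
  by move=> UA UB; apply: filter_ex (filterI UA UB).
have Uconst i : exists ti, U [set j | p i (ab j).1 = ti].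
  exact: ultra_finite_const (pfin i).
pose t i := sval (cid (Uconst i)).
have tP i : U [set j | p i (ab j).1 = t i] by exact: (svalP (cid (Uconst i))).
have Ule i : U [set j | isys_le i j] by apply: tailsU; exists i.
have [x xP] : exists x, forall i, p i x = t i.
  apply: (pd_thread pdp) => i j ij.
  have [k /= [ki kj]] := meetU _ _ (tP i) (tP j).
  by rewrite -ki -kj; exact: (pd_map pdp).
have /(pd_nbhs pdp) [i iphi] := cphi x.
have [k /= [ki ik]] := meetU _ _ (tP i) (Ule i).
have [abk] := abP k; apply.
have phi1 := iphi (ab k).1; have phi2 := iphi (ab k).2; rewrite /= in phi1 phi2.
by rewrite phi1 ?phi2 // ?xP // -(pd_le pdp ik abk).
Qed.

Lemma pd_hausdorff (M : preTopologicalMonoidType) (S : inverse_system)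
    (p : forall i : isys_idx S, M -> isys_obj i) :
  prodiscrete p -> hausdorff_space M.
Proof.
move=> pdp x y xy; apply: (pd_inj pdp) => i.
by have [z [/= <- <-]] := xy _ _ (pd_open pdp i x) (pd_open pdp i y).
Qed.

(** * Closed subgroups are profinite groups *)

Lemma image_subgroup (M N : monoidType) (f : M -> N) (H : set M) :
  monoid_morphism f -> is_subgroup H -> is_subgroup (f @` H).
Proof.
move=> [_ fM] [HM [e [He idP invP]]]; split.
  by move=> _ _ [x Hx <-] [y Hy <-]; exists (x * y); [exact: HM|exact: fM].
exists (f e); split; first by exists e.
  by move=> _ [x Hx <-]; rewrite -!fM; have [-> ->] := idP _ Hx.
move=> _ [x Hx <-]; have [y [Hy xy yx]] := invP _ Hx.
by exists (f y); split; [exists y|rewrite -fM xy|rewrite -fM yx].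
Qed.

Section ClosedSubgroupProfinite.
Context (M : preTopologicalMonoidType) (S : inverse_system).
Context (p : forall i : isys_idx S, M -> isys_obj i) (pdp : prodiscrete p).
Variable H : closed_subgroup M.

(** The image of [H] in each object is again a closed subgroup, of a discrete
    monoid, so that it inherits a group structure. *)
Definition image_csg (i : isys_idx S) :
    closed_subgroup (discrete_topology (isys_obj i)) :=
  @ClosedSubgroup (discrete_topology (isys_obj i)) (p i @` H)
    (@discrete_closed (discrete_topology (isys_obj i)) _)
    (image_subgroup (pd_morph pdp i) (csg_subgroup H)).

Definition csg_proj i (x : csg_type H) : csg_type (image_csg i) :=
  SigSub (mem_set (classical_sets.imageP (p i) (set_valP x))).

(** For [i] and [j] unrelated the transition map need not preserve the images;
    the default value 1 makes [image_map] total. *)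
Definition image_map i j (y : csg_type (image_csg j)) : csg_type (image_csg i) :=
  insubd (1 : csg_type (image_csg i)) (isys_map i (set_val y)).

Lemma val_image_map i j (y : csg_type (image_csg j)) :
  isys_le i j -> set_val (image_map i y) = isys_map i (set_val y).
Proof.
move=> ij; apply: insubdK; apply/mem_set.
have [x Hx xy] := set_valP y; exists x => //.
rewrite -(pd_map pdp _ ij); congr (isys_map i); exact: xy.
Qed.

Fact image_map_morph i j :
  isys_le i j -> monoid_morphism (@image_map i j).
Proof.
move=> ij; apply: group_morphism => x y; apply: val_inj.
have vE := val_image_map _ ij; apply: etrans (vE _) _.
apply: etrans ((isys_morph ij).2 _ _) _; congr mul; exact/esym/vE.
Qed.

Fact image_map_id i (x : csg_type (image_csg i)) : image_map i x = x.
Proof.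
apply: val_inj; rewrite [LHS]val_image_map ?isys_map_id //.
exact: isys_le_refl.
Qed.

Fact image_map_comp i j k (x : csg_type (image_csg k)) :
  isys_le i j -> isys_le j k ->
  image_map i (image_map j x) = image_map i x.
Proof.
move=> ij jk; have ik := isys_le_trans ij jk; apply: val_inj.
by rewrite [LHS]val_image_map // [RHS]val_image_map // val_image_map //
  isys_map_comp.
Qed.

Definition image_system := InverseSystem (isys_inhabited S)
  (@isys_le_refl S) (@isys_le_trans S) (@isys_directed S)
  image_map_morph image_map_id image_map_comp.

(** Closedness of [H] is what makes threads converge in [H]: a point of [M] all of
    whose projections come from [H] is adherent to [H]. *)
Lemma csg_prodiscrete :
  @prodiscrete (csg_type H) image_system csg_proj.
Proof.
split.
- move=> i; apply: group_morphism => x y; apply: val_inj.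
  exact: (pd_morph pdp i).2.
- move=> i j x ij; apply: val_inj.
  by apply: etrans (val_image_map _ ij) _; exact: (pd_map pdp).
- move=> t tP.
  have [x xP] : exists x, forall i, p i x = set_val (t i).
    by apply: (pd_thread pdp) => i j ij; rewrite -val_image_map //; congr set_val; exact: tP.
  have Hx : csg_set H x.
    suff : closure (csg_set H) x by exact: (csg_closed (c := H)).
    move=> U /(pd_nbhs pdp) [i iU].
    have [y Hy yt] := set_valP (t i).
    by exists y; split => //; apply: iU; rewrite xP.
  by exists (SigSub (mem_set Hx)) => i; apply: val_inj => /=; exact: xP.
- move=> x y xy; apply: val_inj; apply: (pd_inj pdp) => i.
  by have /(congr1 val) := xy i.
move=> x U; split=> [|[i iU]].
  move=> [_ [[B Bop <-] Bx BU]].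
  have /(pd_nbhs pdp) [i iB] : nbhs (set_val x) B by apply: open_nbhs_nbhs.
  exists i => y /(congr1 val) yx; apply: BU; exact: iB.
have xU : nbhs x (set_val @^-1` [set y | p i y = p i (set_val x)]).
  by apply: initial_continuous; exact: (pd_open pdp).
apply: filterS xU => y /= yx; apply: iU; exact: val_inj.
Qed.

Lemma csg_profinite :
  (forall i, finite_monoid (isys_obj (i : isys_idx S))) -> profinite_group (csg_type H).
Proof.
move=> pfin; split; last first.
  exists image_system; split; last by apply/projective_limitP; exists csg_proj; exact: csg_prodiscrete.
  move=> i; split; last by move=> x; exists x^-1; rewrite mulgV mulVg.
  exact: finite_setT_inj val_inj (pfin i).
split; first exact: pd_topological_monoid csg_prodiscrete.
move=> x U /(pd_nbhs csg_prodiscrete) [i iU]; apply/(pd_nbhs csg_prodiscrete).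
exists i => y yx; apply: iU; apply: (mulgI (csg_proj i x)).
have pM := (pd_morph csg_prodiscrete i).2.
by rewrite -{1}yx -!pM !mulgV.
Qed.

End ClosedSubgroupProfinite.

(** * Members of a pseudovariety *)

Section DiscreteMonoid.
Variable M : monoidType.

Definition constant_system : inverse_system.
Proof.
refine (@InverseSystem unit (fun _ _ => True) (fun _ => M) (fun _ _ => id)
  (inhabits tt) _ _ _ _ _ _) => //.
Defined.

Lemma discrete_prodiscrete :
  @prodiscrete (discrete_topology M) constant_system (fun _ => id).
Proof.
split=> //.
- by move=> t _; exists (t tt) => -[].
- by move=> x y xy; exact: (xy tt).
move=> x U; rewrite nbhs_principalE principal_filterP.
split=> [Ux|[i iU]]; last exact: iU.
by exists tt => y ->.
Qed.

Lemma discrete_pro (V : monoidType -> Prop) : V M -> pro V (discrete_topology M).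
Proof.
move=> VM; split; first exact: pd_topological_monoid discrete_prodiscrete.
exists constant_system; split=> //; apply/projective_limitP.
by exists (fun _ => id); exact: discrete_prodiscrete.
Qed.

End DiscreteMonoid.

Record submonoid (M : monoidType) := Submonoid {
  submonoid_set :> set M ;
  submonoid1 : submonoid_set 1 ;
  submonoidM : forall x y,
    submonoid_set x -> submonoid_set y -> submonoid_set (x * y) }.

Definition submonoid_type (M : monoidType) (P : submonoid M) : Type :=
  classical_sets.set_type P.

Section SubmonoidType.
Context {M : monoidType} (P : submonoid M).

HB.instance Definition _ :=
  Choice.copy (submonoid_type P) (classical_sets.set_type P).

Definition submonoid_mul (x y : submonoid_type P) : submonoid_type P :=
  SigSub (mem_set (submonoidM (set_valP x) (set_valP y))).
Definition submonoid_one : submonoid_type P := SigSub (mem_set (submonoid1 P)).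

Fact submonoid_mulA : associative submonoid_mul.
Proof. by move=> x y z; apply: val_inj; rewrite /= mulgA. Qed.
Fact submonoid_mul1g : left_id submonoid_one submonoid_mul.
Proof. by move=> x; apply: val_inj; rewrite /= mul1g. Qed.
Fact submonoid_mulg1 : right_id submonoid_one submonoid_mul.
Proof. by move=> x; apply: val_inj; rewrite /= mulg1. Qed.

HB.instance Definition _ := isMonoid.Build (submonoid_type P)
  submonoid_mulA submonoid_mul1g submonoid_mulg1.

Lemma submonoid_val_morphism : monoid_morphism (set_val : submonoid_type P -> M).
Proof. by []. Qed.

End SubmonoidType.

Definition pointwise (I : Type) (K : monoidType) : Type := I -> K.

Section Pointwise.
Context {I : Type} {K : monoidType}.

HB.instance Definition _ := Choice.copy (pointwise I K) (I -> K).

Definition pointwise_mul (f g : pointwise I K) : pointwise I K :=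
  fun i => f i * g i.

Fact pointwise_mulA : associative pointwise_mul.
Proof. by move=> f g h; apply/funext => i; exact: mulgA. Qed.
Fact pointwise_mul1g : left_id (fun=> 1) pointwise_mul.
Proof. by move=> f; apply/funext => i; exact: mul1g. Qed.
Fact pointwise_mulg1 : right_id (fun=> 1) pointwise_mul.
Proof. by move=> f; apply/funext => i; exact: mulg1. Qed.

HB.instance Definition _ := isMonoid.Build (pointwise I K)
  pointwise_mulA pointwise_mul1g pointwise_mulg1.

End Pointwise.

Section PseudovarietyClosure.
Variables (V : monoidType -> Prop) (pvV : pseudovariety V).

Lemma pv_submonoid (M : monoidType) (P : submonoid M) :
  V M -> V (submonoid_type P).
Proof. exact: (pv_sub pvV (submonoid_val_morphism P) val_inj). Qed.

(** Powers with finite exponent are iterated products, up to isomorphism; the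
    exponent is first enumerated as an ordinal. *)
Lemma pv_power (I : choiceType) (K : monoidType) :
  finite_set [set: I] -> V K -> V (pointwise I K).
Proof.
move=> /finite_seqP [s sP] VK.
have Vord n : V (pointwise 'I_n K).
  elim: n => [|n IHn].
    by apply: (pv_trivial pvV) => f; apply/funext => -[].
  apply: (pv_sub pvV _ _ (pv_prod pvV VK IHn)
    (f := fun g : pointwise 'I_n.+1 K =>
            (g ord0, (fun i => g (lift ord0 i)) : pointwise 'I_n K))).
    by split.
  move=> g h [gh0 /funeqP ghS]; apply/funext => i.
  by case: (unliftP ord0 i) => [j ->|->].
apply: (pv_sub pvV _ _ (Vord (size s))
  (f := fun g : pointwise I K =>
          (fun i => g (tnth (in_tuple s) i)) : pointwise 'I_(size s) K)).
  by split.
move=> g h /funeqP gh; apply/funext => x.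
have xs : x \in s by have := Logic.I : [set: I] x; rewrite sP.
by have /tnthP [i ->] : x \in in_tuple s by [].
Qed.

End PseudovarietyClosure.

Section Wreath.
Variables (K M : monoidType).

(** Left action of [M] on functions, by right translation of the argument. *)
Definition translate (m : M) (k : pointwise M K) : pointwise M K :=
  fun r => k (r * m).

Fact translate_endo m : monoid_morphism (translate m). Proof. by []. Qed.
Fact translate1 k : translate 1 k = k.
Proof. by apply/funext => r; rewrite /translate mulg1. Qed.
Fact translateM m m' k : translate (m * m') k = translate m (translate m' k).
Proof. by apply/funext => r; rewrite /translate mulgA. Qed.

Definition translate_action := LeftAction translate_endo translate1 translateM.

Definition wreath := semidirect translate_action.

Lemma pv_wreath (V : monoidType -> Prop) : pseudovariety V ->
  (forall N : monoidType,
     semidirect_pv (fun L : monoidType => V L /\ Ab L) V N <-> V N) ->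
  V K -> Ab K -> V M -> V wreath.
Proof.
move=> pvV hV VK [[_ Kgroup] Kcomm] VM.
have Vpow : V (pointwise M K) := pv_power pvV (pv_finite pvV VM) VK.
apply/hV => P pvP; apply; split=> //; split=> //; split.
  split; first exact: (pv_finite pvV Vpow).
  move=> k; have [i iP] := choice Kgroup.
  exists (fun r => i (k r)).
  by split; apply/funext => r; have [] := iP (k r).
by move=> k l; apply/funext => r; exact: Kcomm.
Qed.

End Wreath.

Section PseudovarietyGroups.
Variables (V : monoidType -> Prop) (pvV : pseudovariety V).

(** A group [B] that is a quotient of a subgroup of [M] is in [V], although the
    identity of the subgroup need not be that of [M]: adjoining the identity of
    [M] to the subgroup gives a submonoid of [M], and sending this identity to 1
    extends the quotient map. *)
Lemma pv_subgroup (M : monoidType) (G : groupType) (q : G -> M) (rT : finGroupType)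
    (B : {group rT}) (phi : G -> rT) :
  V M -> {morph q : x y / x * y} -> {morph phi : x y / x * y} ->
  (forall x y, q x = q y -> phi x = phi y) ->
  (forall x, phi x \in B) -> (forall b, b \in B -> exists x, phi x = b) ->
  V (subg_of B).
Proof.
move=> VM qM phiM q_phi phiB phi_surj.
pose P (m : M) := m = 1 \/ exists x, q x = m.
have PM m m' : P m -> P m' -> P (m * m').
  move=> [->|[x <-]]; first by rewrite mul1g.
  move=> [->|[y <-]]; right; first by exists x; rewrite mulg1.
  by exists (x * y); rewrite qM.
pose T := submonoid_type (@Submonoid M P (or_introl erefl) PM).
have /choice [b bP] (m : M) :
    exists b, (forall x, q x = m -> phi x = b) /\ ((forall x, q x <> m) -> b = 1).
  have [[x xm]|nom] := pselect (exists x, q x = m).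
    by exists (phi x); split=> [y ym|/(_ x)//]; apply: q_phi; rewrite ym xm.
  by exists 1; split=> // x xm; case: nom; exists x.
have bq x : b (q x) = phi x by rewrite -((bP _).1 x).
(* If 1 has a preimage under [q], its image under [phi] is idempotent. *)
have b1 : b 1 = 1.
  have [[x x1]|nox] := pselect (exists x, q x = 1).
    by rewrite -x1 bq; apply: idempotent1; rewrite -phiM; apply: q_phi; rewrite qM x1 mulg1.
  by apply: (bP 1).2 => x x1; apply: nox; exists x.
have bB m : b m \in B.
  have [[x <-]|nox] := pselect (exists x, q x = m); first by rewrite bq.
  by rewrite (bP m).2 // => x xm; apply: nox; exists x.
have bM m m' : P m -> P m' -> b (m * m') = b m * b m'.
  move=> [->|[x <-]]; first by rewrite mul1g b1 mul1g.
  move=> [->|[y <-]]; first by rewrite mulg1 b1 mulg1.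
  by rewrite -qM !bq phiM.
apply: (pv_img pvV _ _ (pv_submonoid pvV (@Submonoid M P (or_introl erefl) PM) VM)
  (f := fun m : T => subg B (b (set_val m)))).
  split; first by apply: val_inj; rewrite /= subgK // b1.
  move=> m m'; apply: val_inj; rewrite /= !subgK //.
  exact: bM (set_valP m) (set_valP m').
move=> c _; have [x xc] := phi_surj _ (valP c).
have Pq : P (q x) by right; exists x.
exists (SigSub (mem_set Pq)) => //; apply: val_inj.
by rewrite /= subgK // bq.
Qed.

Lemma pv_subg (gT : finGroupType) (A B : {group gT}) :
  A \subset B -> V (subg_of B) -> V (subg_of A).
Proof.
move=> sAB; apply: (pv_sub pvV (f := fun a : subg_of A => subg B (sgval a))).
  split; first by apply: val_inj; rewrite /= subgK ?group1.
  by move=> a a'; apply: val_inj; rewrite /= !subgK ?groupM // (subsetP sAB) // subgP.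
move=> a a' /(congr1 sgval); rewrite !subgK ?(subsetP sAB) ?subgP //.
exact: val_inj.
Qed.

Lemma pv_isog (gT hT : finGroupType) (A : {group gT}) (B : {group hT}) :
  A \isog B -> V (subg_of A) -> V (subg_of B).
Proof.
move=> /isogP [g injg gA].
have gB a : a \in A -> g a \in B by move=> Aa; rewrite -gA mem_morphim.
apply: (pv_img pvV (f := fun a : subg_of A => subg B (g (sgval a)))).
  split; first by apply: val_inj; rewrite /= subgK ?morph1.
  move=> a a'; apply: val_inj.
  by rewrite /= !subgK ?gB ?morphM ?groupM ?subgP.
move=> b _; have /morphimP [a Aa _ ab] : sgval b \in g @* A by rewrite gA subgP.
by exists (subg A a) => //; apply: val_inj; rewrite /= !subgK // gB.
Qed.

(** For commuting subgroups multiplication is a morphism from the product. *)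
Lemma pv_joing (gT : finGroupType) (A B : {group gT}) :
  A \subset 'C(B) -> V (subg_of A) -> V (subg_of B) -> V (subg_of (A <*> B)%G).
Proof.
move=> cAB VA VB; have defAB : A <*> B = A * B by rewrite cent_joinEl.
have ABP (x : subg_of A * subg_of B) : sgval x.1 * sgval x.2 \in (A <*> B)%G.
  by rewrite /= defAB mem_mulg ?subgP.
apply: (pv_img pvV _ _ (pv_prod pvV VA VB)
  (f := fun x : subg_of A * subg_of B => subg (A <*> B)%G (sgval x.1 * sgval x.2))).
  split; first by apply: val_inj; rewrite /= subgK ?mulg1 ?group1.
  move=> x y; apply: val_inj.
  rewrite /= (subgK _ (ABP (x * y))) (subgK _ (ABP x)) (subgK _ (ABP y)).
  have xy : commute (sgval x.2) (sgval y.1).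
    by apply/commute_sym/(centsP cAB); exact: subgP.
  by rewrite -!mulgA; congr (_ * _); rewrite !mulgA xy.
move=> c _; have /mulsgP [a b Aa Bb cab] : sgval c \in A * B.
  by rewrite -defAB subgP.
exists (subg A a, subg B b) => //; apply: val_inj.
by rewrite /= !subgK // /= defAB mem_mulg.
Qed.

(** An elementary abelian p-group is generated by commuting cyclic groups that
    are trivial or isomorphic to [<[x]>]. *)
Lemma pv_abelem (p : nat) (gT hT : finGroupType) (x : gT) (E : {group hT}) :
  prime p -> #[x] = p -> V (subg_of <[x]>) -> p.-abelem E -> V (subg_of E).
Proof.
move=> p_pr ox Vx abE.
have V1 : V (subg_of (1%G : {group hT})).
  apply: (pv_trivial pvV) => a; apply: val_inj; exact/set1P/(subgP a).
have Vcycle y : y \in E -> V (subg_of <[y]>).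
  move=> Ey; have [->|nty] := eqVneq y 1.
    by apply: pv_isog V1; rewrite /= cycle1 isog_refl.
  apply: pv_isog Vx; rewrite isog_cyclic_card ?cycle_cyclic //.
  by rewrite -!orderE ox (abelem_order_p abE) ?eqxx.
suff Vgen (s : seq hT) : {subset s <= E} -> V (subg_of <<[set:: s]>>%G).
  have defE : <<[set:: enum E]>>%G = E by apply/val_inj; rewrite /= set_enum genGid.
  by rewrite -defE; apply: Vgen => y; rewrite mem_enum.
elim: s => [|y s IHs] sE.
  by apply: pv_isog V1; rewrite /= set_nil gen0 isog_refl.
have Ey : y \in E by apply: sE; rewrite mem_head.
have sE' : {subset s <= E} by move=> z sz; apply: sE; rewrite inE sz orbT.
have -> : <<[set:: y :: s]>>%G = (<[y]> <*> <<[set:: s]>>)%G.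
  by apply/val_inj; rewrite /= set_cons joing_idl joing_idr.
apply: pv_joing (Vcycle _ Ey) (IHs sE').
have /(abelemP p_pr) [abelE _] := abE.
apply: (centSS _ _ abelE); first by rewrite cycle_subG.
by rewrite gen_subG; apply/subsetP => z; rewrite inE; exact: sE'.
Qed.

End PseudovarietyGroups.

(** * Lifting to the wreath product *)

Section WreathLift.
Context (V : monoidType -> Prop) (pvV : pseudovariety V).
Hypothesis hV : forall M : monoidType,
  semidirect_pv (fun N : monoidType => V N /\ Ab N) V M <-> V M.
Context (aT rT : finGroupType) (A : {group aT}) (f : {morphism A >-> rT}).
Hypotheses (abK : abelian ('ker f)) (VK : V (subg_of ('ker f)%G)).
Context (M : monoidType) (VM : V M) (G : groupType) (q : G -> M) (phi : G -> rT).
Hypotheses (qM : {morph q : x y / x * y}) (phiM : {morph phi : x y / x * y}).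
Hypothesis phi_f : forall x, phi x \in f @* A.
Hypothesis q_phi : forall x y, q x = q y -> phi x = phi y.

Let e : M := q 1.

(** The R-class of the idempotent [e], on which the subgroup [q @` setT] acts
    freely on the left. *)
Let rclass (r : M) : Prop := e * r = r /\ exists u, r * u = e.

Let e_id : e * e = e. Proof. by rewrite -qM mulg1. Qed.

Let mulq1 x : q x * e = q x. Proof. by rewrite -qM mulg1. Qed.

Let mul1q x : e * q x = q x. Proof. by rewrite -qM mul1g. Qed.

Let rclass_act x r : rclass r -> rclass (q x * r).
Proof.
move=> [er [u ru]]; split; first by rewrite mulgA -qM mul1g.
exists (u * q x^-1); rewrite mulgA -(mulgA _ r) ru -mulgA -qM mul1g.
by rewrite -qM mulgV.
Qed.

Let rclass_prefix r m m' : rclass r -> rclass (r * (m * m')) -> rclass (r * m).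
Proof.
move=> [er _] [_ [u ru]]; split; first by rewrite mulgA er.
by exists (m' * u); rewrite -ru !mulgA.
Qed.

Let rclass_e : rclass e.
Proof. by split=> //; exists 1; rewrite mulg1. Qed.

Let rclass_q x : rclass (q x).
Proof. by have := rclass_act x rclass_e; rewrite -qM mulg1. Qed.

Let orbit (r : M) : set M := [set q x * r | x in [set: G]].

Let orbit_act x r : rclass r -> orbit (q x * r) = orbit r.
Proof.
move=> [er _]; apply/seteqP; split=> _ [y _ <-].
  by exists (y * x) => //; rewrite qM mulgA.
by exists (y * x^-1) => //; rewrite mulgA -qM mulgVK.
Qed.

(** Choose a representative in each orbit; the label of [r] is the image under
    [phi] of the element that carries the representative to [r].  This is well
    defined and equivariant because the action on the R-class is free. *)
Lemma equivariant_labelling : exists b : M -> rT,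
  (forall r, b r \in f @* A) /\
  forall x r, rclass r -> b (q x * r) = phi x * b r.
Proof.
pose t r := xget e (orbit r).
have /choice [y yP] r : exists x, q x * r = t r.
  have [x _ xr] : orbit r (t r) by apply: (xgetPex e); exists (q 1 * r); exists 1.
  by exists x.
exists (fun r => (phi (y r))^-1); split=> [r|x r Rr]; first by rewrite groupV.
have [er [u ru]] := Rr.
have tE : t (q x * r) = t r by rewrite /t orbit_act.
have yE : q (y (q x * r)) * (q x * r) = q (y r) * r by rewrite !yP.
have : q (y (q x * r) * x) = q (y r).
  rewrite -[RHS]mulq1 -ru mulgA -yE qM -!mulgA ru /e.
  by rewrite -!qM mulg1.
by move=> /q_phi; rewrite phiM => <-; rewrite invgM mulVKg.
Qed.

(** [T] is a submonoid of the wreath product of the kernel of [f] by [M], [pi] its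
    projection to [M] and [gamma] a set-theoretic section of [pi], which serves
    to lift the generators of a free monoid from [M] to [T].  A lift of [q] to
    [T] carries with it a lift of [phi] to [A], read off by [lambda]. *)
Lemma wreath_lift : exists (T : monoidType) (gamma : M -> T) (pi : T -> M)
    (lambda : T -> aT),
  [/\ V T, monoid_morphism pi, cancel gamma pi &
    forall Phi : G -> T, {morph Phi : x y / x * y} ->
      (forall x, pi (Phi x) = q x) ->
      [/\ {morph lambda \o Phi : x y / x * y},
          forall x, lambda (Phi x) \in A &
          forall x, f (lambda (Phi x)) = phi x]].
Proof.
have [b [bA b_act]] := equivariant_labelling.
have /choice [s sP] : forall y : rT, exists a, a \in A /\ (y \in f @* A -> f a = y).
  move=> y; have [/morphimP [a Aa _ ->]|_] := boolP (y \in f @* A).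
    by exists a.
  by exists 1.
have sA y : s y \in A by case: (sP y).
have sK y : y \in f @* A -> f (s y) = y by case: (sP y).
pose K := subg_of ('ker f)%G.
have AbK : Ab K.
  split; last by move=> k l; apply/val_inj/(centsP abK _ (valP k) _ (valP l)).
  split; first exact: (pv_finite pvV VK).
  by move=> k; exists k^-1; rewrite mulgV mulVg.
(* The element of [A] attached to the path from [r] to [r * m]: for a product
   the intermediate values of [s \o b] cancel out. *)
pose twist (k : M -> K) r m := (s (b r))^-1 * sgval (k r) * s (b (r * m)).
(* Invariance of these elements under the left action of the subgroup. *)
pose P (x : wreath K M) := forall g r, rclass r -> rclass (r * x.2) ->
  twist x.1 (q g * r) x.2 = twist x.1 r x.2.
have P1 : P 1.
  by move=> g r _ _; rewrite /twist /= !mulg1 !mulVg.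
have PM x y : P x -> P y -> P (x * y).
  move=> Px Py g r Rr Rrxy; have Rrx := rclass_prefix Rr Rrxy.
  have twistM r' : twist (x * y).1 r' (x * y).2 =
      twist x.1 r' x.2 * twist y.1 (r' * x.2) y.2.
    by rewrite /twist /= /translate !mulgA mulgK.
  rewrite !twistM Px // -[q g * r * _]mulgA Py //.
  by rewrite -mulgA.
pose T := submonoid_type (Submonoid P1 PM).
(* For an edge inside the R-class, [k0] is chosen to make [twist] equal to
   [s ((b r)^-1 * b (r * m))], which the action does not change. *)
pose k0 m r := if `[< rclass r /\ rclass (r * m) >] then
    s (b r) * s ((b r)^-1 * b (r * m)) * (s (b (r * m)))^-1
  else 1.
have k0K m r : k0 m r \in 'ker f.
  rewrite /k0; case: asboolP => // _.
  have bV : (b r)^-1 * b (r * m) \in f @* A by rewrite groupM ?groupV.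
  have k0A : s (b r) * s ((b r)^-1 * b (r * m)) * (s (b (r * m)))^-1 \in A.
    by rewrite !groupM ?groupV.
  apply/kerP => //; rewrite !morphM ?groupM ?groupV // morphV // !sK //.
  by rewrite mulVKg mulgV.
pose gamma0 m : wreath K M := (fun r => subg ('ker f)%G (k0 m r), m).
have gammaP m : P (gamma0 m).
  move=> g r Rr Rrm; rewrite /twist /= !subgK //.
  have k0E r' : rclass r' -> rclass (r' * m) ->
      (s (b r'))^-1 * k0 m r' * s (b (r' * m)) = s ((b r')^-1 * b (r' * m)).
    move=> Rr' Rr'm; rewrite /k0; case: asboolP => [_|[]//].
    by rewrite -!mulgA mulKg mulVg mulg1.
  rewrite !k0E //; try exact: rclass_act.
    by rewrite -[q g * r * _]mulgA !b_act // invgM -!mulgA mulKg.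
  by rewrite -mulgA; exact: rclass_act.
exists T, (fun m => SigSub (mem_set (gammaP m))), (fun x => (set_val x).2).
(* The element attached to the path from [e] to [e * m], conjugated by [s (b e)]
   so as to lie above [phi] itself and not above a conjugate of it. *)
pose lambda (x : T) :=
  sgval ((set_val x).1 e) * s (b (set_val x).2) * (s (b e))^-1.
exists lambda.
split=> //; first exact: (pv_submonoid pvV _ (pv_wreath pvV hV VK AbK VM)).
move=> Phi PhiM Phiq.
pose k x : M -> K := (set_val (Phi x)).1.
have kM x y r : k (x * y) r = k x r * k y (r * q x).
  by rewrite /k PhiM -(Phiq x).
have lambdaE x : lambda (Phi x) = sgval (k x e) * s (b (q x)) * (s (b e))^-1.
  by rewrite -Phiq.
split.
- move=> x y; rewrite /= !lambdaE kM /= mul1q qM.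
  (* The path of [y] based at [q x] is the translate by [x] of the path of [y]
     based at [e]. *)
  have := set_valP (Phi y) x e rclass_e.
  rewrite Phiq mul1q => /(_ (rclass_q y)); rewrite /twist mulq1 mul1q -/(k y) => twE.
  have /= := congr1 (fun z => sgval (k x e) * s (b (q x)) * z * (s (b e))^-1) twE.
  by rewrite !mulgA mulgK.
- move=> x; rewrite lambdaE !groupM ?groupV //.
  by have /setIP [] : sgval (k x e) \in 'ker f := valP (k x e).
- move=> x; rewrite lambdaE.
  have /morphpreP [kA /set1P fk] : sgval (k x e) \in 'ker f := valP (k x e).
  rewrite !morphM ?groupM ?groupV // morphV // !sK // fk mul1g.
  by rewrite -[q x]mulq1 b_act // mulgK.
Qed.

End WreathLift.

(** * Lifting through epimorphisms of finite groups *)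

Section Lifting.
Context (V : monoidType -> Prop) (pvV : pseudovariety V).
Hypothesis hV : forall M : monoidType,
  semidirect_pv (fun N : monoidType => V N /\ Ab N) V M <-> V M.
Context (X : topologicalType) (F : preTopologicalMonoidType) (iota : X -> F).
Hypothesis freeF : is_free_pro V iota.
Variable H : closed_subgroup F.

Definition has_lift (aT rT : finGroupType) (A : {group aT})
    (f : {morphism A >-> rT}) (phi : csg_type H -> rT) : Prop :=
  exists psi : csg_type H -> aT,
    [/\ continuous (psi : _ -> discrete_topology aT), {morph psi : x y / x * y},
        forall x, psi x \in A & forall x, f (psi x) = phi x].

Lemma csg_factor (D : choiceType) (phi : csg_type H -> discrete_topology D) :
  continuous phi -> exists (M : monoidType) (p : F -> discrete_topology M),
  [/\ V M, continuous p, monoid_morphism (p : F -> M) &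
    forall x y : csg_type H, p (set_val x) = p (set_val y) -> phi x = phi y].
Proof.
move=> cphi; have [[_ [S [VS /projective_limitP [p pdp]]]] _ _] := freeF.
have [i iphi] := pd_factor (csg_prodiscrete pdp H)
  (fun i => finite_setT_inj val_inj (pv_finite pvV (VS i))) cphi.
exists (isys_obj (i : isys_idx S)), (p i); split.
- exact: VS.
- exact: pd_continuous.
- exact: pd_morph.
- by move=> x y xy; apply: iphi; apply: val_inj.
Qed.

(** The composite with [pi] agrees with [p] by the uniqueness part of the universal
    property. *)
Lemma free_lift (M T : monoidType) (p : F -> discrete_topology M)
    (gamma : M -> T) (pi : T -> M) :
  V M -> V T -> continuous p -> monoid_morphism (p : F -> M) ->
  monoid_morphism pi -> cancel gamma pi ->
  exists P : F -> discrete_topology T,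
    [/\ continuous P, monoid_morphism (P : F -> T) & forall x, pi (P x) = p x].
Proof.
move=> VM VT cp pM piM gammaK; have [_ ciota free] := freeF.
have ciotap : continuous (p \o iota) by move=> x; apply: continuous_comp; [exact: ciota|exact: cp].
have [P [[cP PM PE] _]] := free _ (gamma \o (p \o iota) : X -> discrete_topology T)
  (discrete_pro VT) (continuous_discrete_comp ciotap).
exists P; split=> // x.
have [g [_ guniq]] := free _ (p \o iota) (discrete_pro VM) ciotap.
have -> : p = g by apply/esym/guniq; split.
suff : g = (pi \o P) by move=> ->.
apply: guniq; split; first exact: continuous_discrete_comp.
  by split; [rewrite /= PM.1 piM.1|move=> y z; rewrite /= PM.2 piM.2].
by move=> y; rewrite /= PE /= gammaK.
Qed.

Lemma csg_val_continuous : continuous (set_val : csg_type H -> F).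
Proof. exact: initial_continuous. Qed.

Section EmbeddingProblem.
Variables (aT rT : finGroupType) (A : {group aT}) (f : {morphism A >-> rT}).
Variable phi : csg_type H -> rT.
Hypotheses (cphi : continuous (phi : _ -> discrete_topology rT))
  (phiM : {morph phi : x y / x * y}) (phi_f : forall x, phi x \in f @* A).

Lemma lift_kernel_in_V :
  abelian ('ker f) -> V (subg_of ('ker f)%G) -> has_lift f phi.
Proof.
move=> abK VK; have [M [p [VM cp pM p_phi]]] := csg_factor cphi.
pose q (x : csg_type H) : M := p (set_val x).
have qM : {morph q : x y / x * y} by move=> x y; exact: pM.2.
have [T [gamma [pi [lambda [VT piM gammaK liftP]]]]] :=
  wreath_lift pvV hV abK VK VM qM phiM phi_f p_phi.
have [P [cP PM piP]] := free_lift VM VT cp pM piM gammaK.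
have [] := liftP (fun x => P (set_val x)).
- by move=> x y; exact: PM.2.
- by move=> x; exact: piP.
move=> psiM psiA psif; exists (lambda \o (fun x => P (set_val x))); split=> //.
apply: continuous_discrete_comp => x; apply: continuous_comp; last exact: cP.
exact: csg_val_continuous.
Qed.

(** On [C] the morphism [f] is an isomorphism onto its image, and its inverse does
    the lifting. *)
Lemma lift_injective (C : {group aT}) :
  C \subset A -> 'ker f :&: C = 1 -> (forall x, phi x \in f @* C) -> has_lift f phi.
Proof.
move=> sCA tiC phiC.
have /choice [s sP] (y : rT) : exists c, c \in C /\ (y \in f @* C -> f c = y).
  have [/morphimP [c _ Cc ->]|_] := boolP (y \in f @* C); first by exists c.
  by exists 1; split.
have sC y : s y \in C by case: (sP y).
have sK x : f (s (phi x)) = phi x by case: (sP (phi x)) => _; apply.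
have CA c : c \in C -> c \in A by exact: subsetP.
exists (s \o phi); split=> //; first exact: continuous_discrete_comp.
- move=> x y; apply/eqP; rewrite eq_mulVg1 /=; apply/eqP/set1gP.
  rewrite -tiC; apply/setIP; split; last by rewrite !groupM ?groupV ?sC.
  apply/kerP.
    by rewrite !groupM ?groupV ?CA ?sC.
  by rewrite !morphM ?groupM ?groupV ?CA ?sC // morphV ?CA ?sC // !sK phiM mulVg.
- by move=> x; apply: CA; exact: sC.
Qed.

(** Either p divides the order of the image [B] of [phi], so that [B], a member of
    [V], contains a cyclic group of order p and the kernel is in [V]; or the
    kernel is a normal Hall subgroup of the preimage of [B] and has a
    complement there. *)
Lemma lift_abelem (p : nat) : prime p -> p.-abelem ('ker f) -> has_lift f phi.
Proof.
move=> p_pr abelK; have abK := abelem_abelian abelK.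
have imageP : group_set (finset (fun b => `[< exists x, phi x = b >])).
  apply/group_setP; split=> [|b c].
    rewrite inE; apply/asboolP; exists 1; apply: idempotent1.
    by rewrite -phiM mulg1.
  rewrite !inE => /asboolP [x <-] /asboolP [y <-]; apply/asboolP.
  by exists (x * y).
pose B : {group rT} := Group imageP.
have BP b : b \in B <-> exists x, phi x = b.
  by rewrite inE; split=> /asboolP.
have phiB x : phi x \in B by apply/BP; exists x.
have sBf : B \subset f @* A.
  by apply/subsetP => b /BP [x <-].
have [p_B|p'B] := boolP (p %| #|B|).
  apply: lift_kernel_in_V => //.
  have [b Bb ob] := Cauchy p_pr p_B.
  have [M [q [VM _ qM q_phi]]] := csg_factor cphi.
  have VB : V (subg_of B).
    apply: (pv_subgroup pvV (q := fun x : csg_type H => q (set_val x) : M) (phi := phi) VM) => //.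
      by move=> x y; exact: qM.2.
    by move=> c /BP.
  apply: (pv_abelem pvV p_pr ob _ abelK).
  by apply: pv_subg VB => //; rewrite cycle_subG.
pose A1 := (f @*^-1 B)%G.
have sKA1 : 'ker f \subset A1 by apply: morphpreS; exact: sub1G.
have sA1A : A1 \subset A by exact: subsetIl.
have nKA1 : 'ker f <| A1.
  exact: normalS sKA1 sA1A (ker_normal f).
have hallK : Hall A1 ('ker f).
  have cardA1 : #|A1| = (#|'ker f| * #|B|)%N by exact: card_morphpre.
  rewrite /Hall sKA1 -divgS // cardA1 mulKn ?cardG_gt0 //.
  by rewrite (pnat_coprime (abelem_pgroup abelK)) // p'natE.
have /splitsP [C /complP [tiKC defA1]] := SchurZassenhaus_split hallK nKA1.
have sCA1 : C \subset A1 by rewrite -defA1 mulG_subr.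
apply: (lift_injective (C := C)) => //; first exact: subset_trans sCA1 sA1A.
move=> x; have : phi x \in f @* A1 by rewrite morphpreK ?phiB.
rewrite -defA1 morphimMl ?morphim_ker ?mul1g //.
exact: subset_trans sKA1 sA1A.
Qed.

End EmbeddingProblem.

Lemma quotient_factor (aT rT : finGroupType) (A L : {group aT})
    (f : {morphism A >-> rT}) : L <| A -> L \subset 'ker f ->
  exists (pi : {morphism A >-> coset_of L}) (g : {morphism (pi @* A)%G >-> rT}),
    [/\ 'ker pi = L, pi @* A = A / L, g @* (pi @* A) = f @* A &
        forall a, a \in A -> g (pi a) = f a].
Proof.
move=> nsLA sLK; have nLA := normal_norm nsLA.
pose pi := [morphism of restrm nLA (coset L)].
have kerpi : 'ker pi = L.
  by rewrite ker_restrm ker_coset (setIidPr (normal_sub nsLA)).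
have impi : pi @* A = A / L by rewrite im_restrm.
have kpf : 'ker pi \subset 'ker f by rewrite kerpi.
pose g := [morphism of factm kpf (subxx A)].
exists pi, g; split=> //; first exact: morphim_factm.
by move=> a Aa; exact: factmE.
Qed.

(** Induction on the order of [A].  If a proper subgroup of [A] maps onto a group
    containing the image of [phi], lift to it.  Otherwise the Frattini argument
    shows that the normalizer of a Sylow subgroup [P] of the kernel is all of
    [A].  A minimal normal subgroup [L] of [A] inside [P] is elementary abelian,
    and one lifts first to [A / L], then from [A / L] to [A]. *)
Lemma lift_finite (aT rT : finGroupType) (A : {group aT})
    (f : {morphism A >-> rT}) (phi : csg_type H -> rT) :
  continuous (phi : _ -> discrete_topology rT) ->
  {morph phi : x y / x * y} -> (forall x, phi x \in f @* A) -> has_lift f phi.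
Proof.
have [n] := ubnP #|A|; elim: n => // n IHn in aT rT A f phi * => /ltnSE leAn.
move=> cphi phiM phiA.
have [[C ltCA phiC]|minA] := pselect (exists2 C : {group aT}, C \proper A &
    forall x, phi x \in f @* C).
  have sCA := proper_sub ltCA.
  pose g := [morphism of restrm sCA f].
  have [psi [cpsi psiM psiC psiE]] : has_lift g phi.
    apply: IHn => //; first exact: leq_trans (proper_card ltCA) leAn.
    by move=> x; rewrite im_restrm.
  exists psi; split=> // x; exact: subsetP sCA _ (psiC x).
have [kerf1|[p p_pr p_K]] := trivgVpdiv ('ker f).
  by apply: (lift_injective cphi phiM (C := A)) => //; rewrite kerf1 (setIidPl (sub1G A)).
have [P sylP] := Sylow_exists p ('ker f).
have nsKA : 'ker f <| A := ker_normal f.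
have sPK := pHall_sub sylP.
have sPA := subset_trans sPK (normal_sub nsKA).
have nPA : A \subset 'N(P).
  apply: contrapT => /negP nPA; apply: minA; exists 'N_A(P)%G.
    rewrite properEneq subsetIl andbT; apply: contra nPA => /eqP/setIidPl //.
  have defA : 'ker f * 'N_A(P) = A by apply: Frattini_arg sylP.
  have <- : f @* ('ker f * 'N_A(P)) = f @* 'N_A(P).
    by rewrite morphimMl ?(normal_sub nsKA) // morphim_ker mul1g.
  by move=> x; rewrite defA.
have ntP : P :!=: 1.
  by rewrite -cardG_gt1 (card_Hall sylP) p_part_gt1 mem_primes p_pr cardG_gt0.
have [L minL sLP] := minnormal_exists ntP nPA.
have /mingroupP [/andP [ntL nLA] _] := minL.
have [_ _ /is_abelemP [r r_pr abelL]] :=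
  minnormal_solvable minL sLP (pgroup_sol (pHall_pgroup sylP)).
have nsLA : L <| A by rewrite /normal nLA (subset_trans sLP sPA).
have [pi [g [kerpi impi img gE]]] :=
  quotient_factor nsLA (subset_trans sLP sPK).
have ltLA : (#|pi @* A| < #|A|)%N.
  by rewrite impi ltn_quotient ?(normal_sub nsLA).
have [psi1 [cpsi1 psi1M psi1A psi1E]] : has_lift g phi.
  apply: IHn => //; last by move=> x; rewrite img.
  exact: leq_trans ltLA leAn.
have [psi [cpsi psiM psiA psiE]] : has_lift pi psi1.
  by apply: (lift_abelem cpsi1 psi1M _ r_pr) => //; rewrite kerpi.
exists psi; split=> // x.
by rewrite -gE // psiE.
Qed.

End Lifting.

(** * Projectivity and torsion-freeness *)

(** The powers of a torsion element [x] of [H] form a finite, hence closed,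
    subgroup [C] of [M], which embeds in [H] by [j]. *)
Lemma cyclic_closed_subgroup (M : preTopologicalMonoidType)
    (H : closed_subgroup M) (x : csg_type H) (n : nat) :
  hausdorff_space M -> (0 < n)%N -> x ^+ n = 1 ->
  exists (C : closed_subgroup M) (j : csg_type C -> csg_type H),
    [/\ monoid_morphism j, injective j, finite_set [set: csg_type C],
        (forall z, exists k, j z = x ^+ k) & exists y, j y = x].
Proof.
move=> hM n_gt0 xn.
pose powers : set (csg_type H) := [set x ^+ k | k in `I_n].
have powersP k : powers (x ^+ k) by exists (k %% n)%N; rewrite /= ?ltn_pmod ?monoid_expg_mod.
have powersI k : x ^+ k * x ^+ (k * n.-1) = 1.
  by rewrite -expgnDr -mulnS prednK // mulnC expgnA xn expg1n.
have powers_fin : finite_set powers by apply: finite_image; exact: finite_II.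
have val_fin : finite_set (set_val @` powers : set M) by exact: finite_image.
have valM (y z : csg_type H) : set_val (y * z) = set_val y * set_val z by [].
have powers_subgroup : is_subgroup (set_val @` powers : set M).
  split=> [_ _ [_ [i _ <-] <-] [_ [k _ <-] <-]|].
    by exists (x ^+ (i + k)); rewrite // expgnDr.
  exists (set_val (1 : csg_type H)); split; first by exists 1; rewrite // -(expg0 x).
    by move=> _ [y _ <-]; rewrite -!valM mul1g mulg1.
  move=> _ [_ [k _ <-] <-]; exists (set_val (x ^+ (k * n.-1))).
  split; first by exists (x ^+ (k * n.-1)).
    by rewrite -valM powersI.
  by rewrite -valM -expgnDr addnC expgnDr powersI.
pose C := ClosedSubgroup (finite_hausdorff_closed hM val_fin) powers_subgroup.
have /choice [j jP] (z : csg_type C) : exists y, powers y /\ set_val y = set_val z.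
  by have [y yP yz] := set_valP z; exists y.
have jM : {morph j : y z / y * z}.
  move=> y z; apply: val_inj; apply: etrans (jP (y * z)).2 _.
  by apply: etrans _ (esym (valM _ _)); rewrite (jP y).2 (jP z).2.
have j_inj : injective j.
  by move=> y z jyz; apply: val_inj; rewrite -[LHS](jP y).2 jyz; exact: (jP z).2.
exists C, j; split=> //; first exact: group_morphism.
- have -> : [set: csg_type C] = j @^-1` powers.
    by apply/esym/seteqP; split=> // z _; have [] := jP z.
  by apply: finite_preimage => // y z _ _; exact: j_inj.
- by move=> z; have [[k _ xk] _] := jP z; exists k.
have Cx : csg_set C (set_val x) by exists x; rewrite // -(expg1 x).
exists (SigSub (mem_set Cx)); apply: val_inj; exact: (jP _).2.
Qed.

Section FreeProMonoid.
Context (V : monoidType -> Prop) (pvV : pseudovariety V).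
Hypothesis hV : forall M : monoidType,
  semidirect_pv (fun N : monoidType => V N /\ Ab N) V M <-> V M.
Context (X : topologicalType) (F : preTopologicalMonoidType) (iota : X -> F).
Hypothesis freeF : is_free_pro V iota.

Lemma closed_subgroup_projective (H : closed_subgroup F) :
  projective_profinite_group (csg_type H).
Proof.
have [[_ [S [VS /projective_limitP [p pdp]]]] _ _] := freeF.
split; first by apply: (csg_profinite pdp) => i; exact: pv_finite (VS i).
move=> A B alpha phi [alpha1 alphaM] alpha_surj cphi [phi1 phiM] _.
have alphaDM : {in [set: A]%SET &, {morph alpha : a b / a * b}}.
  by move=> a b _ _; exact: alphaM.
have [psi [cpsi psiM _ psiE]] : @has_lift F H A B [set: A]%G (Morphism alphaDM) phi.
  apply: (lift_finite pvV hV freeF) => // x.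
  have [a _ <-] := alpha_surj (phi x) I.
  by apply: (mem_morphim (Morphism alphaDM)); rewrite inE.
by exists psi; split=> //; exact: group_morphism.
Qed.

(** Let [m] be the order of [x], and lift the isomorphism from the group generated
    by [x] to a cyclic group of order [m] through the cyclic group of order
    [m ^ 2].  The lift of [x] is killed by [m], so it is an [m]-th power, whose
    image downstairs is trivial. *)
Lemma closed_subgroup_torsion_free (H : closed_subgroup F) :
  torsion_free (csg_type H).
Proof.
have [[_ [S [VS /projective_limitP [p pdp]]]] _ _] := freeF.
move=> x n n_gt0 xn; apply: contrapT => x1.
have [m [m_gt0 xm m_min]] : exists m, [/\ (0 < m)%N, x ^+ m = 1 &
    forall k, (0 < k < m)%N -> x ^+ k <> 1].
  have ex_m : exists m, (0 < m)%N && (x ^+ m == 1) by exists n; rewrite n_gt0 xn eqxx.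
  have := ex_minnP ex_m.
  case=> m /andP [m_gt0 /eqP xm] m_min; exists m; split=> // k /andP [k_gt0 km] xk.
  by have := m_min k; rewrite k_gt0 xk eqxx leqNgt km => /(_ isT).
have expx_eq i k : x ^+ i = x ^+ k -> i = k %[mod m].
  rewrite -(monoid_expg_mod i xm) -(monoid_expg_mod k xm).
  have := ltn_pmod k m_gt0; have := ltn_pmod i m_gt0.
  move: (i %% m)%N (k %% m)%N => {}i {}k.
  wlog ik : i k / i <= k => [wl im km /esym ki|im km ki].
    by have [/wl|/ltnW/wl] := leqP i k; [apply|move=> /(_ km im ki)].
  apply/eqP; rewrite eqn_leq ik /= leqNgt; apply/negP => lt_ik.
  apply: (m_min (k - i)%N); first by rewrite subn_gt0 lt_ik ltn_subLR // ltn_addl.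
  by rewrite expgnFr // ki mulgV.
have m_gt1 : (1 < m)%N.
  by case: m m_gt0 xm {m_min expx_eq} => [|[|m]].
have [C [j [jM j_inj Cfin jC [y jy]]]] :=
  cyclic_closed_subgroup (pd_hausdorff pdp) m_gt0 xm.
pose b : 'I_m.-1.+1 := Zp1; pose a : 'I_(m * m).-1.+1 := Zp1.
have ob : #[b] = m by rewrite order_Zp1 prednK.
have oa : #[a] = (m * m)%N by rewrite order_Zp1 prednK // muln_gt0 m_gt0.
have dvd_ba : #[b] %| #[a] by rewrite ob oa dvdn_mulr.
have [log logP] := choice jC.
pose phi z := b ^+ log z.
have phiE z k : j z = x ^+ k -> phi z = b ^+ k.
  rewrite logP => /expx_eq ik; apply/eqP.
  by rewrite eq_expg_mod_order ob; apply/eqP.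
have phiM : {morph phi : z w / z * w}.
  by move=> z w; rewrite /phi -expgnDr; apply: phiE; rewrite jM.2 !logP expgnDr.
pose f := [morphism of eltm dvd_ba].
have im_f : f @* <[a]> = <[b]> by rewrite morphim_cycle ?cycle_id //= eltm_id.
have Chaus := pd_hausdorff (csg_prodiscrete pdp C).
have [psi [_ psiM psiA psiE]] : @has_lift F C _ _ _ f phi.
  apply: (lift_finite pvV hV freeF) => //.
    exact: finite_hausdorff_continuous.
  by move=> z; rewrite im_f mem_cycle.
have ym : y ^+ m = 1.
  by apply: j_inj; rewrite monoid_morphismX // jy xm jM.1.
have /cycleP [i psi_y] := psiA y.
have m_i : m %| i.
  rewrite -(dvdn_pmul2r m_gt0) -oa order_dvdn expgnA -psi_y.
  by rewrite -monoid_morphismX ?ym; [rewrite (group_morphism psiM).1|exact: group_morphism].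
have : phi y = 1.
  by rewrite -psiE psi_y /= eltmE; apply/eqP; rewrite -order_dvdn ob.
rewrite (phiE y 1%N) ?jy ?expg1 // => b1.
by move: m_gt1; rewrite -ob b1 order1.
Qed.

End FreeProMonoid.

Theorem theorem1 (V : monoidType -> Prop) (pvV : pseudovariety V)
    (hV : forall M : monoidType,
        semidirect_pv (fun N : monoidType => V N /\ Ab N) V M <-> V M)
    (X : topologicalType) (F : preTopologicalMonoidType) (iota : X -> F)
    (freeF : is_free_pro V iota) (H : closed_subgroup F) :
  projective_profinite_group (csg_type H) /\ torsion_free (csg_type H).
Proof.
split; first exact: (closed_subgroup_projective pvV hV freeF).
exact: (closed_subgroup_torsion_free pvV hV freeF).
Qed.
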